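(* Every complete epoch schedule conserves the local class counts: if $(q^{(t)})_t$ is a schedule for which the remaining support reaches $r=0$ at the end of the epoch, then $$\sum_tq_{k,m}^{(t)}=n_{k,m}\qquad\text{for all clients } k \text{ and classes } m.$$ Consequently, since clients draw unused examples without replacement, every local example is used exactly once in the epoch.
   Context: Clients $k\in\{1,\dots,K\}$, classes $m\in\{1,\dots,M\}$. Client $k$ holds $n_{k,m}\in\mathbb Z_{\ge0}$ examples of class $m$. $r^{(t)}_{k,m}$ is the number of unused class-$m$ examples at client $k$ before step $t$, with initial value $n_{k,m}$. At step $t$ a schedule specifies integers $q^{(t)}_{k,m}$ with $0\le q^{(t)}_{k,m}\le r^{(t)}_{k,m}$, and the support is updated by $r^{(t+1)}_{k,m}=r^{(t)}_{k,m}-q^{(t)}_{k,m}$. A schedule is complete if after its final step all $r_{k,m}$ equal $0$ (the final batch may be partial). When the schedule is executed, at step $t$ client $k$ draws, for each class $m$, $q^{(t)}_{k,m}$ distinct examples from those of its class-$m$ examples not yet used in the epoch. *)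

(* Defs.v *)
From mathcomp Require Import all_boot.

Set Implicit Arguments.
Unset Strict Implicit.
Unset Printing Implicit Defensive.

(* A schedule of T steps is a family q t k m together with T; steps are
   numbered 0, ..., T - 1, and the values of q at t >= T are irrelevant.
   [support n q t k m] is the number of unused class-m examples at client k
   before step t. The subtraction is truncated, but [is_schedule] guarantees
   that it is exact at every step t < T. *)
Fixpoint support (K M : nat) (n : 'I_K -> 'I_M -> nat)
    (q : nat -> 'I_K -> 'I_M -> nat) (t : nat) (k : 'I_K) (m : 'I_M) : nat :=
  if t is t'.+1 then support n q t' k m - q t' k m else n k m.

Definition is_schedule (K M : nat) (n : 'I_K -> 'I_M -> nat) (T : nat)
    (q : nat -> 'I_K -> 'I_M -> nat) : Prop :=
  forall t k m, t < T -> q t k m <= support n q t k m.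

Definition complete (K M : nat) (n : 'I_K -> 'I_M -> nat) (T : nat)
    (q : nat -> 'I_K -> 'I_M -> nat) : Prop :=
  forall k m, support n q T k m = 0.

(* Client k holds the examples X k, the class of x being [cls k x]. *)
Definition has_class_counts (K M : nat) (X : 'I_K -> finType)
    (cls : forall k, X k -> 'I_M) (n : 'I_K -> 'I_M -> nat) : Prop :=
  forall k m, #|[set x : X k | cls k x == m]| = n k m.

(* [d t k m] lists the class-m examples drawn by client k at step t. *)
Definition used_before (K M : nat) (X : 'I_K -> finType)
    (d : nat -> forall k : 'I_K, 'I_M -> seq (X k))
    (t : nat) (k : 'I_K) (x : X k) : Prop :=
  exists s m, s < t /\ x \in d s k m.

(* A possible outcome of the (random) draws when q is executed for T steps. *)
Definition executes (K M : nat) (X : 'I_K -> finType)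
    (cls : forall k, X k -> 'I_M) (T : nat)
    (q : nat -> 'I_K -> 'I_M -> nat)
    (d : nat -> forall k : 'I_K, 'I_M -> seq (X k)) : Prop :=
  forall t k m, t < T ->
    [/\ size (d t k m) = q t k m,
        uniq (d t k m) &
        forall x, x \in d t k m -> cls k x = m /\ ~ used_before d t x].

Definition times_used (K M : nat) (X : 'I_K -> finType) (T : nat)
    (d : nat -> forall k : 'I_K, 'I_M -> seq (X k)) (k : 'I_K) (x : X k) : nat :=
  \sum_(t < T) \sum_(m < M) count_mem x (d t k m).

(* Main.v *)
Require Import Defs.
From mathcomp Require Import all_boot.

(** The support decreases by exactly q at each step, so the drawn amounts
    telescope to n. For one client and one class, concatenating all draws gives
    a duplicate-free list inside the class whose length is the size of the
    class; hence the list exhausts the class, each element occurring once. *)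

(** The bound in [is_schedule] makes each truncated subtraction exact, so a step adds to the sum
    just what it removes from the support. *)
Lemma sum_schedule_support (K M : nat) (n : 'I_K -> 'I_M -> nat) (T : nat)
    (q : nat -> 'I_K -> 'I_M -> nat) (k : 'I_K) (m : 'I_M) (t : nat) :
  is_schedule n T q -> t <= T ->
  \sum_(s < t) q s k m + Defs.support n q t k m = n k m.
Proof.
move=> hq; elim: t => [|t IH] ltT; first by rewrite big_ord0.
by rewrite big_ord_recr /= -addnA subnKC ?hq // IH // ltnW.
Qed.

Definition drawn {K M : nat} {X : 'I_K -> finType}
    (d : nat -> forall k : 'I_K, 'I_M -> seq (X k)) (k : 'I_K) (m : 'I_M)
    (t : nat) : seq (X k) :=
  flatten [seq d s k m | s <- iota 0 t].

Section Drawn.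

Context {K M : nat} {X : 'I_K -> finType} {cls : forall k, X k -> 'I_M}.
Context {T : nat} {q : nat -> 'I_K -> 'I_M -> nat}.
Context {d : nat -> forall k : 'I_K, 'I_M -> seq (X k)}.
Hypothesis hd : executes cls T q d.

Lemma mem_drawn (k : 'I_K) (m : 'I_M) (t : nat) (x : X k) :
  reflect (exists2 s, s < t & x \in d s k m) (x \in drawn d k m t).
Proof.
apply: (iffP flatten_mapP) => -[s].
  by rewrite mem_iota add0n => /andP[_ ltst] xs; exists s.
by move=> ltst xs; exists s; rewrite ?mem_iota.
Qed.

Lemma drawnS (k : 'I_K) (m : 'I_M) (t : nat) :
  drawn d k m t.+1 = drawn d k m t ++ d t k m.
Proof. by rewrite /drawn -addn1 iotaD map_cat flatten_cat /= cats0. Qed.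

Lemma size_drawn (k : 'I_K) (m : 'I_M) (t : nat) :
  t <= T -> size (drawn d k m t) = \sum_(s < t) q s k m.
Proof.
elim: t => [|t IH] ltT; first by rewrite big_ord0.
have [szd _ _] := hd t k m ltT.
by rewrite drawnS size_cat big_ord_recr /= IH ?szd // ltnW.
Qed.

Lemma uniq_drawn (k : 'I_K) (m : 'I_M) (t : nat) :
  t <= T -> uniq (drawn d k m t).
Proof.
elim: t => [//|t IH] ltT; have [_ ud xd] := hd t k m ltT.
rewrite drawnS cat_uniq IH ?ud ?andbT /=; last exact: ltnW.
apply/hasPn => x /xd[_ unused]; apply/negP => /mem_drawn[s ltst xs].
by apply: unused; exists s, m.
Qed.

Lemma drawn_class (k : 'I_K) (m : 'I_M) (x : X k) :
  x \in drawn d k m T -> cls k x = m.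
Proof. by case/mem_drawn=> s ltsT; have [_ _ xd] := hd s k m ltsT; case/xd. Qed.

(** Draws respect classes, so at each step only the summand for the class of [x] can be nonzero. *)
Lemma times_used_drawn (k : 'I_K) (x : X k) :
  times_used T d x = count_mem x (drawn d k (cls k x) T).
Proof.
rewrite /times_used /drawn count_flatten sumnE !big_map.
(* Viewing [iota 0 T] as [index_iota 0 T] turns the list sum into a sum over ordinals, to be
   compared step by step. *)
rewrite -[in iota 0 T](subn0 T) -/(index_iota 0 T) big_mkord; apply: eq_bigr => t _.
rewrite (bigD1 (cls k x)) //= big1 ?addn0 // => m neqm.
apply/count_memPn/negP; have [_ _ xd] := hd t k m (ltn_ord t).
by case/xd => eqm _; rewrite eqm eqxx in neqm.
Qed.

End Drawn.

Theorem mainTheorem7 (K M : nat) (n : 'I_K -> 'I_M -> nat)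
    (T : nat) (q : nat -> 'I_K -> 'I_M -> nat)
    (hq : is_schedule n T q) (hcomplete : complete n T q) :
  (forall (k : 'I_K) (m : 'I_M), \sum_(t < T) q t k m = n k m) /\
  (forall (X : 'I_K -> finType) (cls : forall k : 'I_K, X k -> 'I_M)
      (d : nat -> forall k : 'I_K, 'I_M -> seq (X k)),
    has_class_counts cls n ->
    executes cls T q d ->
    forall (k : 'I_K) (x : X k), times_used T d x = 1).
Proof.
have total k m : \sum_(t < T) q t k m = n k m.
  by rewrite -(sum_schedule_support _ _ _ _ _ k m T hq) // hcomplete addn0.
split=> // X cls d counts hd k x.
(* In a duplicate-free list a count is a membership bit, so it remains to show that [x] is drawn at
   all. *)
rewrite (times_used_drawn hd) (count_uniq_mem _ (uniq_drawn hd _ _ _ _)) //.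
set m := cls k x.
have sub : {subset drawn d k m T <= enum [set y : X k | cls k y == m]}.
  by move=> y /(drawn_class hd) ym; rewrite mem_enum inE ym.
(* Pigeonhole: a duplicate-free list inside the class and at least as long as its enumeration has
   the same members. *)
have [|_ eqmem] := uniq_min_size (uniq_drawn hd k m T (leqnn T)) sub.
  by rewrite -cardE counts (size_drawn hd) // total.
by rewrite eqmem mem_enum inE eqxx.
Qed.
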